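(* Let $K\subset\mathbb{R}^2$ be a polygonal cell, let $\mathbf{x}_K\in K$ be an interior point of $K$ with respect to which $K$ is star-shaped, let $\mathbf{v}_1,\mathbf{v}_2,\dots,\mathbf{v}_m$ be some vertices of $K$, and let $(\alpha_1,\dots,\alpha_m)\in\mathbb{R}^m$ be such that $$\sum_{i=1}^m \alpha_i\mathbf{v}_i=\mathbf{x}_K\quad\text{and}\quad \sum_{i=1}^m\alpha_i=1.$$ Let $\mathbf{u}$ be an $\mathbb{RT}_0$ function over the cell $K$, that is, $\mathbf{u}(\mathbf{x})=a\mathbf{x}+\mathbf{b}$ for some $a\in\mathbb{R}$ and $\mathbf{b}\in\mathbb{R}^2$. For all $i=1,\dots,m$, define the flux of $\mathbf{u}$ through the internal edge $\sigma_i^*=[\mathbf{v}_i,\mathbf{x}_K]$ by $$F_{\sigma_i^*}=\int_{\sigma_i^*}\mathbf{u}\cdot\mathbf{n}_{\sigma_i^*},$$ where $\mathbf{n}_{\sigma_i^*}$ is the clockwise unit normal to $\sigma_i^*$. Then $$\sum_{i=1}^m\alpha_i F_{\sigma_i^*}=0.$$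
   Context: The space dimension is $d=2$. A cell $K$ is a star-shaped polygon in $\mathbb{R}^2$. For a vertex $\mathbf{v}_i$ of $K$, the internal edge $\sigma_i^*$ is the line segment $[\mathbf{v}_i,\mathbf{x}_K]$ joining $\mathbf{v}_i$ to $\mathbf{x}_K$, and $|\sigma_i^*|=|\mathbf{x}_K-\mathbf{v}_i|$ is its length. The clockwise unit normal $\mathbf{n}_{\sigma_i^*}$ is the unit vector such that $|\sigma_i^*|\,\mathbf{n}_{\sigma_i^*}=\mathrm{Rot}(\mathbf{x}_K-\mathbf{v}_i)$, where $\mathrm{Rot}:\mathbb{R}^2\to\mathbb{R}^2$ is the clockwise rotation by $\pi/2$. The integral over $\sigma_i^*$ is with respect to arc length. *)

(* Defs.v *)
From HB Require Import structures.
From mathcomp Require Import all_boot all_order all_algebra.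
From mathcomp Require Import all_classical all_reals all_analysis.

Set Implicit Arguments.
Unset Strict Implicit.
Unset Printing Implicit Defensive.

Import Order.TTheory GRing.Theory Num.Theory.
Import numFieldNormedType.Exports.

Local Open Scope classical_set_scope.
Local Open Scope ring_scope.

(* The library norm on 'rV[R]_2 is the sup norm: it is used here only for the
   topology and for boundedness; lengths are measured with enorm. *)

Definition dot (R : realType) (x y : 'rV[R]_2) : R :=
  \sum_(k < 2) x 0 k * y 0 k.

Definition enorm (R : realType) (x : 'rV[R]_2) : R := Num.sqrt (dot x x).

(* Clockwise rotation by pi/2: (x_0, x_1) is sent to (x_1, - x_0). *)
Definition Rot (R : realType) (x : 'rV[R]_2) : 'rV[R]_2 :=
  \row_(k < 2) (if k == 0 then x 0 1 else - x 0 0).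

Definition seg_point (R : realType) (p q : 'rV[R]_2) (t : R) : 'rV[R]_2 :=
  (1 - t) *: p + t *: q.

Definition segment (R : realType) (p q : 'rV[R]_2) : set 'rV[R]_2 :=
  seg_point p q @` `[0, 1].

Definition star_shaped (R : realType) (K : set 'rV[R]_2) (x : 'rV[R]_2) :=
  forall y, K y -> segment x y `<=` K.

Definition frontier (T : topologicalType) (A : set T) : set T :=
  closure A `\` interior A.

(* The closed polygonal chain with edges [w i, w (i + 1 mod n)] does not
   intersect itself; each edge is parametrised by [0, 1) so that every point
   of the chain is reached exactly once. *)
Definition simple_chain (R : realType) (n : nat) (w : 'I_n -> 'rV[R]_2) :=
  forall (i j : 'I_n) (s t : R), 0 <= s < 1 -> 0 <= t < 1 ->
    seg_point (w i) (w (ordS i)) s = seg_point (w j) (w (ordS j)) t ->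
    i = j /\ s = t.

(* K is a polygon with vertices w: a bounded set with nonempty interior whose
   boundary is the simple closed chain w.  Which boundary points belong to K is
   left free, so that both open and closed cells are covered; flat angles are
   allowed at the vertices. *)
Definition polygon (R : realType) (K : set 'rV[R]_2)
    (n : nat) (w : 'I_n -> 'rV[R]_2) :=
  [/\ (3 <= n)%N,
      simple_chain w,
      bounded_set K,
      interior K !=set0 &
      frontier K = \bigcup_(i in [set: 'I_n]) segment (w i) (w (ordS i))].

(* The closure of K is used because K need not contain its boundary, on which
   a segment joining a vertex to the star centre may lie. *)
Definition RT0 (R : realType) (K : set 'rV[R]_2)
    (u : 'rV[R]_2 -> 'rV[R]_2) :=
  exists (a : R) (b : 'rV[R]_2), forall x, closure K x -> u x = a *: x + b.

(* Integral of f over [p, q] for the arc length s, through the unit speed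
   parametrisation of [p, q]. *)
Definition segment_integral (R : realType) (p q : 'rV[R]_2)
    (f : 'rV[R]_2 -> R) : R :=
  \int[lebesgue_measure]_(s in `[0, enorm (q - p)])
    f (p + (s / enorm (q - p)) *: (q - p)).

(* Clockwise unit normal to [v, x]; see cw_normalP. *)
Definition cw_normal (R : realType) (v x : 'rV[R]_2) : 'rV[R]_2 :=
  (enorm (x - v))^-1 *: Rot (x - v).

Definition flux (R : realType) (u : 'rV[R]_2 -> 'rV[R]_2)
    (v x : 'rV[R]_2) : R :=
  segment_integral v x (fun y => dot (u y) (cw_normal v x)).

Lemma dotE (R : realType) (x y : 'rV[R]_2) :
  dot x y = x 0 0 * y 0 0 + x 0 1 * y 0 1.
Proof.
rewrite /dot big_ord_recl big_ord1.
by congr (_ + x 0 _ * y 0 _); apply: val_inj.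
Qed.

Lemma enorm_gt0 (R : realType) (x : 'rV[R]_2) : x != 0 -> 0 < enorm x.
Proof.
move=> x0; rewrite sqrtr_gt0 dotE -!expr2 lt0r addr_ge0 ?sqr_ge0// andbT.
apply: contra x0; rewrite paddr_eq0 ?sqr_ge0// !sqrf_eq0 => /andP[/eqP h0 /eqP h1].
apply/eqP/rowP => k; rewrite mxE.
have [->|->] : k = 0 \/ k = 1.
  by case: k => -[|[|//]] i; [left|right]; apply: val_inj.
- exact: h0.
- exact: h1.
Qed.

Lemma enorm_Rot (R : realType) (x : 'rV[R]_2) : enorm (Rot x) = enorm x.
Proof. by rewrite /enorm !dotE !mxE /= mulrNN addrC. Qed.

Lemma enormZ (R : realType) (c : R) (x : 'rV[R]_2) :
  enorm (c *: x) = `|c| * enorm x.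
Proof.
rewrite /enorm !dotE !mxE -sqrtr_sqr -sqrtrM ?sqr_ge0//.
by congr Num.sqrt; rewrite mulrDr expr2; congr (_ + _); rewrite mulrACA.
Qed.

Lemma cw_normalP (R : realType) (v x n : 'rV[R]_2) : v != x ->
  n = cw_normal v x <-> enorm n = 1 /\ enorm (x - v) *: n = Rot (x - v).
Proof.
rewrite eq_sym -subr_eq0 => /enorm_gt0 l0; split=> [->|[_ Hn]].
  split; first by rewrite enormZ enorm_Rot gtr0_norm ?invr_gt0// mulVf// gt_eqF.
  by rewrite scalerA divff ?scale1r// gt_eqF.
by rewrite /cw_normal -Hn scalerA mulVf ?scale1r// gt_eqF.
Qed.

(* Main.v *)
Require Import Defs.
From HB Require Import structures.
From mathcomp Require Import all_boot all_order all_algebra.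
From mathcomp Require Import all_classical all_reals all_analysis.
From mathcomp Require Import ring.

(** Along the edge [[p, q]] the field value [a x + b] differs from [a p + b]
    by a multiple of [q - p], which is orthogonal to [Rot (q - p)].  Hence the
    flux is determined by the value of the field at [p] ([flux_affine]):
      F = (a p + b) . Rot (q - p) = p . (a Rot q + Rot b) + b . Rot q,
    the second form because [p . Rot p = 0] and [b . Rot p = - p . Rot b]
    ([dot_affine_Rot]).  The quadratic term in [p] has disappeared: for a fixed
    [q = xK], [F] is an affine function of the vertex [p].  Affine functions
    commute with combinations of weights of sum 1, so the sum is the value of
    [F] at the barycentre [p = xK], where [q - p] is zero.

    The field is affine on the closure of the cell only, so the internal edges
    have to lie there.  They do because a vertex is a boundary point and
    the closure of a star-shaped set is star-shaped
    ([star_shaped_closure]). *)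

Import Order.TTheory GRing.Theory Num.Theory.
Import numFieldNormedType.Exports.

Local Open Scope classical_set_scope.
Local Open Scope ring_scope.

Section dot_Rot.
Context {R : realType}.
Implicit Types x y z p q : 'rV[R]_2.

Lemma dotDl x y z : dot (x + y) z = dot x z + dot y z.
Proof. by rewrite !dotE !mxE; ring. Qed.

Lemma dotZl c x y : dot (c *: x) y = c * dot x y.
Proof. by rewrite !dotE !mxE; ring. Qed.

Lemma dotZr c x y : dot x (c *: y) = c * dot x y.
Proof. by rewrite !dotE !mxE; ring. Qed.

Lemma dot_Rotxx x : dot x (Rot x) = 0.
Proof. by rewrite dotE !mxE /=; ring. Qed.

Lemma dot_suml (I : Type) (r : seq I) (F : I -> 'rV[R]_2) y :
  dot (\sum_(i <- r) F i) y = \sum_(i <- r) dot (F i) y.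
Proof.
elim/big_rec2: _ => [|i x z _ <-]; last by rewrite dotDl.
by rewrite dotE !mxE !mul0r addr0.
Qed.

Lemma enorm_ge0 x : 0 <= enorm x.
Proof. exact: sqrtr_ge0. Qed.

(** The contraction towards the centre with a fixed ratio is continuous and
    maps [K] into itself, hence it maps the closure of [K] into itself. *)
Lemma star_shaped_closure (K : set 'rV[R]_2) x :
  star_shaped K x -> star_shaped (closure K) x.
Proof.
move=> starK y clKy _ [t t01 <-] B nbhsB.
have cont : {for y, continuous (fun z => seg_point x z t)}.
  apply: (@cvgD _ 'rV[R]_2 _ (nbhs y)); first exact: cvg_cst.
  by apply: (@cvgZl_tmp _ 'rV[R]_2 _ (nbhs y)); exact: cvg_id.
have [z [Kz Bz]] := clKy _ (cont _ nbhsB).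
by exists (seg_point x z t); split=> //; apply: (starK z) => //; exists t.
Qed.

Lemma segment_integral_cst p q (f : 'rV[R]_2 -> R) c :
  (forall y, segment q p y -> f y = c) ->
  segment_integral p q f = c * enorm (q - p).
Proof.
move=> fc; rewrite /segment_integral.
under eq_Rintegral => s.
  rewrite inE /= in_itv /= => /andP[s0 sl].
  rewrite fc; last first.
    exists (1 - s / enorm (q - p)).
      rewrite /= in_itv /= subr_ge0 gerBl divr_ge0 ?enorm_ge0 // andbT.
      have [->|l0] := eqVneq (enorm (q - p)) 0; first by rewrite invr0 mulr0.
      by rewrite ler_pdivrMr ?mul1r // lt0r l0 enorm_ge0.
    by rewrite /seg_point; apply/rowP => k; rewrite !mxE; ring.
  over.
rewrite Rintegral_cst //= lebesgue_measure_itv /= lte_fin.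
have [l0|] := ltP 0 (enorm (q - p)); first by rewrite oppr0 addr0.
move=> l0; suff -> : enorm (q - p) = 0 by [].
by apply/eqP; rewrite eq_le l0 enorm_ge0.
Qed.

(** The integrand is constant, [q - p] being orthogonal to the normal.  The
    formula also holds when [p = q]: the normal is then the zero vector. *)
Lemma flux_affine (u : 'rV[R]_2 -> 'rV[R]_2) a b p q :
  (forall y, segment q p y -> u y = a *: y + b) ->
  flux u p q = dot (a *: p + b) (Rot (q - p)).
Proof.
move=> uE; rewrite /flux.
rewrite (@segment_integral_cst _ _ _ (dot (a *: p + b) (cw_normal p q))).
  rewrite /cw_normal dotZr mulrAC.
  have [->|qp] := eqVneq q p.
    by rewrite subrr dotE !mxE /=; ring.
  by rewrite mulVf ?mul1r // gt_eqF // enorm_gt0 // subr_eq0.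
move=> y qpy; rewrite uE //; case: qpy => t _ <-.
have -> : a *: seg_point q p t + b = a *: p + b + (a * (1 - t)) *: (q - p).
  by rewrite /seg_point; apply/rowP => k; rewrite !mxE; ring.
by rewrite /cw_normal !dotZr dotDl dotZl dot_Rotxx mulr0 addr0.
Qed.

Lemma dot_affine_Rot a b p q :
  dot (a *: p + b) (Rot (q - p)) =
  dot p (a *: Rot q + Rot b) + dot b (Rot q).
Proof. by rewrite !dotE !mxE /=; ring. Qed.

End dot_Rot.

Lemma polygon_vertex_closure (R : realType) (K : set 'rV[R]_2) n
    (w : 'I_n -> 'rV[R]_2) (j : 'I_n) : polygon K w -> closure K (w j).
Proof.
case=> _ _ _ _ frK.
suff: frontier K (w j) by case.
rewrite frK; exists j => //; exists 0; first by rewrite /= in_itv /= lexx ler01.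
by rewrite /seg_point subr0 scale1r scale0r addr0.
Qed.

Theorem lemma2p3 (R : realType)
    (K : set 'rV[R]_2) (n : nat) (w : 'I_n -> 'rV[R]_2)
    (hK : polygon K w)
    (xK : 'rV[R]_2) (hxK : interior K xK) (hstar : star_shaped K xK)
    (m : nat) (v : 'I_m -> 'rV[R]_2)
    (hv : forall i : 'I_m, exists j : 'I_n, v i = w j)
    (alpha : 'I_m -> R)
    (hbary : \sum_(i < m) alpha i *: v i = xK)
    (hsum : \sum_(i < m) alpha i = 1)
    (u : 'rV[R]_2 -> 'rV[R]_2) (hu : RT0 K u) :
  \sum_(i < m) alpha i * flux u (v i) xK = 0.
Proof.
case: hu => a [b uE].
have fluxE i : flux u (v i) xK =
    dot (v i) (a *: Rot xK + Rot b) + dot b (Rot xK).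
  rewrite -dot_affine_Rot; apply: flux_affine => y vy; apply: uE.
  have [j vj] := hv i; apply: (star_shaped_closure _ _ hstar (v i)) vy.
  by rewrite vj; exact: (polygon_vertex_closure _ _ _ _ _ hK).
under eq_bigr do rewrite fluxE mulrDr -dotZl.
rewrite big_split /= -dot_suml hbary -mulr_suml hsum mul1r.
(* The sum is now the flux formula evaluated at a vertex placed at [xK]. *)
by rewrite -dot_affine_Rot subrr dotE !mxE /=; ring.
Qed.
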